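(* Let $X$ be a real vector space and suppose that, for each $n\in\mathbb{N}$ and each $n$-tuple $\boldsymbol{x}=(x_1,\ldots,x_n)\in X^n$, there is a linear map $\Phi_{\boldsymbol{x}}\colon H_n\to X$ such that the following two conditions are satisfied: (1) $\Phi_{\boldsymbol{x}}(\pi_i^{(n)})=x_i$ for each $n\in\mathbb{N}$, $\boldsymbol{x}=(x_1,\ldots,x_n)\in X^n$ and $i\in\{1,\ldots,n\}$; (2) $\Phi_{(\Phi_{\boldsymbol{x}}(f_1),\ldots,\Phi_{\boldsymbol{x}}(f_m))}(g)=\Phi_{\boldsymbol{x}}\bigl(g\circ(f_1\times\cdots\times f_m)\bigr)$ for each $m,n\in\mathbb{N}$, $\boldsymbol{x}\in X^n$, $f_1,\ldots,f_m\in H_n$ and $g\in H_m$, where $f_1\times\cdots\times f_m\colon\mathbb{R}^n\to\mathbb{R}^m$ is defined by $(f_1\times\cdots\times f_m)(t)=(f_1(t),\ldots,f_m(t))$. Then $X$ admits the structure of a vector lattice (that is, a partial order making the given vector space $X$ a vector lattice), and $\boldsymbol{x}\mapsto\Phi_{\boldsymbol{x}}$ is a positively homogeneous continuous function calculus for $X$ with respect to this lattice structure. Moreover, $X$ (with this lattice structure) is Archimedean if and only if $\ker\Phi_{\boldsymbol{x}}$ is closed in $H_n$ for each $n\in\mathbb{N}$ and $\boldsymbol{x}\in X^n$.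
   Context: All vector spaces and vector lattices are over $\mathbb{R}$, and $\mathbb{N}=\{1,2,\ldots\}$. A vector lattice homomorphism is a linear map preserving $\vee$ and $\wedge$. A vector lattice $X$ is Archimedean if, whenever $x,y\in X^+$ satisfy $nx\le y$ for each $n\in\mathbb{N}$, it follows that $x=0$. A function $f\colon\mathbb{R}^n\to\mathbb{R}$ is positively homogeneous if $f(\lambda t)=\lambda f(t)$ for each $\lambda\in[0,\infty)$ and $t\in\mathbb{R}^n$. For $n\in\mathbb{N}$, $H_n$ denotes the vector lattice (with pointwise operations) of positively homogeneous, continuous functions $\mathbb{R}^n\to\mathbb{R}$, and $\pi_i^{(n)}\in H_n$ is the $i$-th coordinate projection $(t_1,\ldots,t_n)\mapsto t_i$. A positively homogeneous continuous function calculus for a vector lattice $X$ is a map $\boldsymbol{x}\mapsto\Phi_{\boldsymbol{x}}$ assigning to each $n\in\mathbb{N}$ and each $\boldsymbol{x}=(x_1,\ldots,x_n)\in X^n$ a vector lattice homomorphism $\Phi_{\boldsymbol{x}}\colon H_n\to X$ such that $\Phi_{\boldsymbol{x}}(\pi_i^{(n)})=x_i$ for $i\in\{1,\ldots,n\}$. Topology on $H_n$: let $S_{\ell_\infty^n}=\{(t_1,\ldots,t_n)\in\mathbb{R}^n:\max_{1\le j\le n}|t_j|=1\}$. The restriction map $f\mapsto f\!\upharpoonright_{S_{\ell_\infty^n}}$ is a vector lattice isomorphism of $H_n$ onto $C(S_{\ell_\infty^n})$, and $H_n$ is given the topology obtained by identifying it via this map with the Banach lattice $C(S_{\ell_\infty^n})$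 with the supremum norm; that is, the topology of the norm $\|f\|_\infty=\sup\{|f(t)|:t\in S_{\ell_\infty^n}\}$. *)

(* Defs.v *)
From HB Require Import structures.
From mathcomp Require Import all_boot all_order all_algebra.
From mathcomp Require Import all_classical all_reals all_analysis.

Set Implicit Arguments.
Unset Strict Implicit.
Unset Printing Implicit Defensive.

Import Order.TTheory GRing.Theory Num.Theory.
Import numFieldNormedType.Exports.

Local Open Scope classical_set_scope.
Local Open Scope ring_scope.

(* A vector lattice structure on a given real vector space [X]. The last two
   fields say that [vjoin x y] (resp. [vmeet x y]) is the least upper
   (resp. greatest lower) bound of [x] and [y]. *)
Record vectorLattice (R : realType) (X : lmodType R) := VectorLattice {
  vle : X -> X -> Prop;
  vjoin : X -> X -> X;
  vmeet : X -> X -> X;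
  vle_refl : forall x, vle x x;
  vle_anti : forall x y, vle x y -> vle y x -> x = y;
  vle_trans : forall x y z, vle x y -> vle y z -> vle x z;
  vle_add : forall x y z, vle x y -> vle (x + z) (y + z);
  vle_scale : forall (a : R) x y, 0 <= a -> vle x y -> vle (a *: x) (a *: y);
  vjoinP : forall x y z, vle (vjoin x y) z <-> vle x z /\ vle y z;
  vmeetP : forall x y z, vle z (vmeet x y) <-> vle z x /\ vle z y }.

Definition archimedean (R : realType) (X : lmodType R)
    (L : vectorLattice X) : Prop :=
  forall x y : X, vle L 0 x -> vle L 0 y ->
    (forall n : nat, (0 < n)%N -> vle L (x *+ n) y) -> x = 0.

Record vlhom (R : realType) (X Y : lmodType R) (L : vectorLattice X)
    (M : vectorLattice Y) (f : X -> Y) : Prop := VLHom {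
  vlhom_linear : linear f;
  vlhom_join : forall x y, f (vjoin L x y) = vjoin M (f x) (f y);
  vlhom_meet : forall x y, f (vmeet L x y) = vmeet M (f x) (f y) }.

Definition pos_homogeneous (R : realType) (n : nat) (f : 'rV[R]_n -> R) : Prop :=
  forall (a : R) (t : 'rV[R]_n), 0 <= a -> f (a *: t) = a * f t.

Definition phc (R : realType) (n : nat) : {pred 'rV[R]_n -> R} :=
  [pred f : 'rV[R]_n -> R | `[< pos_homogeneous f /\ continuous f >]].

Record Hn (R : realType) (n : nat) := MkH {
  Hfun :> 'rV[R]_n -> R;
  _ : Hfun \in @phc R n }.

Section HTheory.
Context {R : realType}.

HB.instance Definition _ n := [isSub for @Hfun R n].
HB.instance Definition _ n := [Choice of Hn R n by <:].

Lemma phcP n (f : 'rV[R]_n -> R) :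
  reflect (pos_homogeneous f /\ continuous f) (f \in @phc R n).
Proof. exact: asboolP. Qed.

Lemma H_homog n (f : Hn R n) : pos_homogeneous f.
Proof. by have /phcP[] := valP f. Qed.

Lemma H_cont n (f : Hn R n) : continuous f.
Proof. by have /phcP[] := valP f. Qed.

Fact phc_submod n : submod_closed (@phc R n).
Proof.
split=> [|a f g /phcP[hf cf] /phcP[hg cg]]; apply/phcP; split.
- by move=> b t _; rewrite /= mulr0.
- exact: (@cst_continuous _ R).
- move=> b t b0.
  by rewrite !fctE hf// hg// /GRing.scale/= mulrCA mulrDr.
- move=> t.
  exact: (cvgD (cvgM (cvg_cst a) (cf t)) (cg t)).
Qed.

HB.instance Definition _ n :=
  GRing.isSubmodClosed.Build R ('rV[R]_n -> R) (@phc R n) (@phc_submod n).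
HB.instance Definition _ n := [SubChoice_isSubLmodule of Hn R n by <:].

Definition sphere n : set 'rV[R]_n := [set t | `|t| = 1].

(* On ['rV[R]_n] the library norm is the max norm. *)
Lemma sphere_max n (t : 'rV[R]_n) :
  sphere t <-> \big[Order.max/0]_(j < n) `|t ord0 j| = 1.
Proof.
suff -> : \big[Order.max/0]_(j < n) `|t ord0 j| = `|t| by [].
rewrite [RHS]/Num.norm/= mx_normrE.
apply/eqP; rewrite eq_le; apply/andP; split; apply/bigmax_leP; split => //=.
- exact: bigmax_ge_id.
- by move=> j _; apply: (le_bigmax _ _ (ord0, j)).
- exact: bigmax_ge_id.
- by move=> [i j] _; rewrite (ord1 i); apply: (le_bigmax _ _ j).
Qed.

Definition Hnorm n (f : Hn R n) : R := sup [set `|f t| | t in @sphere n].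

Lemma Hfun0 n (f : Hn R n) : f 0 = 0.
Proof. by rewrite -(scale0r (0 : 'rV[R]_n)) H_homog// mul0r. Qed.

Lemma sphere_compact n : compact (@sphere n).
Proof.
apply: bounded_closed_compact.
  by exists 1; split => // M M1 t /= ->; exact: ltW.
have -> : @sphere n = Num.norm @^-1` [set 1 : R] by [].
by apply: (continuous_closedP _).1; [exact: norm_continuous|exact: closed_eq].
Qed.

Lemma Hnorm_bounded n (f : Hn R n) :
  has_ubound [set `|f t| | t in @sphere n].
Proof.
have [S0|/set0P[t0 St0]] := eqVneq (@sphere n) set0.
  by exists 0 => y [t]; rewrite S0.
have cf : {within @sphere n, continuous (fun t => `|f t|)}.
  apply: continuous_subspaceT => t.
  apply: (@continuous_comp _ _ _ f Num.norm); first exact: H_cont.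
  exact: norm_continuous.
have [c _ cmax] := compact_EVT_max (ex_intro _ t0 St0) (@sphere_compact n) cf.
by exists `|f c| => y [t St <-]; apply: cmax; rewrite inE.
Qed.

Lemma Hnorm_ub n (f : Hn R n) (t : 'rV[R]_n) : sphere t -> `|f t| <= Hnorm f.
Proof. by move=> St; apply: ub_le_sup; [exact: Hnorm_bounded|exists t]. Qed.

Lemma Hnorm_ge0 n (f : Hn R n) : 0 <= Hnorm f.
Proof.
have [S0|/set0P[t St]] := eqVneq (@sphere n) set0.
  by rewrite /Hnorm S0 image_set0 sup0.
exact: le_trans (normr_ge0 _) (Hnorm_ub f St).
Qed.

Lemma Hnorm_le n (f : Hn R n) (M : R) : 0 <= M ->
  (forall t, sphere t -> `|f t| <= M) -> Hnorm f <= M.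
Proof.
move=> M0 fM; rewrite /Hnorm.
have [->|/set0P S0] := eqVneq [set `|f t| | t in @sphere n] set0.
  by rewrite sup0.
by apply: ge_sup => // _ [t St <-]; exact: fM.
Qed.

Fact Hnorm_triangle n (f g : Hn R n) : Hnorm (f + g) <= Hnorm f + Hnorm g.
Proof.
apply: Hnorm_le => [|t St]; first by rewrite addr_ge0// Hnorm_ge0.
by rewrite (le_trans (ler_normD (f t) (g t)))// lerD// Hnorm_ub.
Qed.

Fact HnormZ n (a : R) (f : Hn R n) : Hnorm (a *: f) = `|a| * Hnorm f.
Proof.
have le_Z (b : R) (g : Hn R n) : Hnorm (b *: g) <= `|b| * Hnorm g.
  apply: Hnorm_le => [|t St]; first by rewrite mulr_ge0// Hnorm_ge0.
  by rewrite (normrM b (g t)) ler_wpM2l// Hnorm_ub.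
apply/eqP; rewrite eq_le le_Z/=.
have [->|a0] := eqVneq a 0; first by rewrite normr0 mul0r Hnorm_ge0.
rewrite -ler_pdivlMl ?normr_gt0// -normfV.
by rewrite -[f in X in X <= _](scalerK a0) le_Z.
Qed.

Fact Hnorm0_eq0 n (f : Hn R n) : Hnorm f = 0 -> f = 0.
Proof.
move=> f0; apply/val_inj/funext => t /=.
have [->|t0] := eqVneq t 0; first exact: Hfun0.
have nt : 0 < `|t| by rewrite normr_gt0.
have St : sphere (`|t|^-1 *: t).
  by rewrite /sphere/= normrZ normfV normr_id mulVf// gt_eqF.
have /eqP : `|f (`|t|^-1 *: t)| = 0.
  by apply/eqP; rewrite eq_le normr_ge0 -{1}f0 Hnorm_ub.
rewrite normr_eq0 H_homog ?invr_ge0 ?normr_ge0// mulf_eq0 invr_eq0.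
by rewrite gt_eqF//= => /eqP.
Qed.

HB.instance Definition _ n := Lmodule_isNormed.Build R (Hn R n)
  (@Hnorm_triangle n) (@HnormZ n) (@Hnorm0_eq0 n).

Fact Hproj_subproof n (i : 'I_n) : (fun t : 'rV[R]_n => t ord0 i) \in @phc R n.
Proof.
by apply/phcP; split=> [a t _|t]; [rewrite mxE|exact: coord_continuous].
Qed.

Definition Hproj n (i : 'I_n) : Hn R n := MkH (Hproj_subproof i).

Fact Hcomp_subproof m n (g : Hn R m) (f : 'I_m -> Hn R n) :
  (fun t : 'rV[R]_n => g (\row_i f i t)) \in @phc R n.
Proof.
apply/phcP; split=> [a t a0|t].
  rewrite -H_homog//; congr (g _); apply/rowP => i.
  by rewrite !mxE H_homog.
apply: (@continuous_comp _ _ _ (fun t => \row_i f i t) g); last exact: H_cont.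
apply/(@cvg_ballP _ _ _ _ (nbhs_filter t)) => e e0.
have fe : \forall s \near t, forall k, ball (f k t) e (f k s).
  apply: (@filter_forall _ _ _ (nbhs t) (nbhs_filter t)) => k.
  exact: (@H_cont _ (f k) t _ (nbhsx_ballx (f k t) e e0)).
by apply: filterS fe => s fe; split => // i j; rewrite !mxE.
Qed.

(* The composition $g \circ (f_1 \times \cdots \times f_m)$. *)
Definition Hcomp m n (g : Hn R m) (f : 'I_m -> Hn R n) : Hn R n :=
  MkH (Hcomp_subproof g f).

Fact Hmax_subproof n (f g : Hn R n) : (f \max g) \in @phc R n.
Proof.
apply/phcP; split=> [a t a0|t]; last by apply: continuous_max; exact: H_cont.
by rewrite /= !H_homog// maxr_pMr.
Qed.

Fact Hmin_subproof n (f g : Hn R n) : (f \min g) \in @phc R n.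
Proof.
apply/phcP; split=> [a t a0|t]; last by apply: continuous_min; exact: H_cont.
by rewrite /= !H_homog// minr_pMr.
Qed.

Definition Hle n (f g : Hn R n) : Prop := forall t, f t <= g t.
Definition Hmax n (f g : Hn R n) : Hn R n := MkH (Hmax_subproof f g).
Definition Hmin n (f g : Hn R n) : Hn R n := MkH (Hmin_subproof f g).

Fact Hle_refl n (f : Hn R n) : Hle f f.
Proof. by move=> t. Qed.

Fact Hle_anti n (f g : Hn R n) : Hle f g -> Hle g f -> f = g.
Proof.
move=> fg gf; apply/val_inj/funext => t; apply/eqP.
by rewrite eq_le fg gf.
Qed.

Fact Hle_trans n (f g h : Hn R n) : Hle f g -> Hle g h -> Hle f h.
Proof. by move=> fg gh t; exact: le_trans (gh t). Qed.

Fact Hle_add n (f g h : Hn R n) : Hle f g -> Hle (f + h) (g + h).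
Proof. by move=> fg t; exact: lerD (fg t) (lexx (h t)). Qed.

Fact Hle_scale n (a : R) (f g : Hn R n) :
  0 <= a -> Hle f g -> Hle (a *: f) (a *: g).
Proof. by move=> a0 fg t; exact: ler_wpM2l a0 _ _ (fg t). Qed.

Fact HmaxP n (f g h : Hn R n) : Hle (Hmax f g) h <-> Hle f h /\ Hle g h.
Proof.
split=> [fgh|[fh gh] t]; last by rewrite ge_max fh gh.
by split=> t; have := fgh t; rewrite ge_max => /andP[].
Qed.

Fact HminP n (f g h : Hn R n) : Hle h (Hmin f g) <-> Hle h f /\ Hle h g.
Proof.
split=> [hfg|[hf hg] t]; last by rewrite le_min hf hg.
by split=> t; have := hfg t; rewrite le_min => /andP[].
Qed.

Definition Hlattice n : vectorLattice (Hn R n) :=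
  VectorLattice (@Hle_refl n) (@Hle_anti n) (@Hle_trans n) (@Hle_add n)
    (@Hle_scale n) (@HmaxP n) (@HminP n).

End HTheory.

(* The arity is written [n.+1] because it ranges over the positive integers. *)
Record function_calculus (R : realType) (X : lmodType R) (L : vectorLattice X)
    (Phi : forall n : nat, ('I_n.+1 -> X) -> Hn R n.+1 -> X) : Prop :=
  FunctionCalculus {
    calculus_hom : forall (n : nat) (x : 'I_n.+1 -> X),
      vlhom (Hlattice n.+1) L (Phi n x);
    calculus_proj : forall (n : nat) (x : 'I_n.+1 -> X) (i : 'I_n.+1),
      Phi n x (Hproj i) = x i }.

(* Main.v *)
Require Import Defs.
From HB Require Import structures.
From mathcomp Require Import all_boot all_order all_algebra.
From mathcomp Require Import all_classical all_reals all_analysis.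
From mathcomp Require Import lra.
Import Order.TTheory GRing.Theory Num.Theory.
Import numFieldNormedType.Exports.
Local Open Scope classical_set_scope.
Local Open Scope ring_scope.

(** The composition law says that whatever the calculus computes from elements
    [Phi x f_1, ..., Phi x f_m] can be computed inside [Hn] first. Setting
    [x \/ y := Phi_(x, y) (max)], and likewise for the meet, every [Phi x]
    therefore turns pointwise maxima into joins ([Phi_max]). Since any three
    elements of [X] are values of a single [Phi x] ([common_calculus]), every
    equation between terms in [+], scalars, join and meet that holds for real
    numbers, hence pointwise in [Hn], holds in [X]: this gives the vector
    lattice axioms once [x <= y] is read as the equation [x \/ y = y].

    If kernels are closed and [n x <= y] for all [n], then [Phi_(x, y)] kills
    the functions [(t_1 - t_2 / n)^+], which converge uniformly on the sphere
    to [t_1^+]; so [x^+ = 0]. Conversely, if [X] is Archimedean and [f] is a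
    limit of elements of the kernel, then for every [n] some [g] in the kernel
    satisfies [|f| <= |g| + e / n], where [e] is the max norm of [R^n], itself
    an element of [Hn]. Applying [Phi x] gives
    [n |Phi x f| <= Phi x e] for every [n], whence [Phi x f = 0]. *)

(** * Positively homogeneous functions *)

Lemma dist_maxr (R : realDomainType) (c a b : R) :
  `|Num.max c a - Num.max c b| <= `|a - b|.
Proof.
have [ab|ba] := ger0P (a - b); rewrite ler_norml;
  case: (leP c a) => ?; case: (leP c b) => ?; apply/andP; split; lra.
Qed.

Section PositivelyHomogeneous.
Context {R : realType} {n : nat}.
Implicit Types f g : Hn R n.

Lemma Hn_ext f g : (forall t, f t = g t) -> f = g.
Proof. by move=> fg; apply/val_inj/funext. Qed.

Lemma Hmulrn_fun f k t : (f *+ k) t = f t *+ k.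
Proof.
elim: k => [//|k IH]; rewrite !mulrS -IH.
by [].
Qed.

(** By homogeneity the bound on the sphere spreads to the whole space. With
    [normH] below it makes uniform smallness on the sphere an inequality of the
    lattice [Hn], which a lattice homomorphism preserves. *)
Lemma le_Hnorm_norm f t : `|f t| <= Hnorm f * `|t|.
Proof.
have [->|t0] := eqVneq t 0; first by rewrite Hfun0 !normr0 mulr0.
have nt : 0 < `|t| by rewrite normr_gt0.
have St : sphere (`|t|^-1 *: t).
  by rewrite /sphere/= normrZ normfV normr_id mulVf// gt_eqF.
have := Hnorm_ub f St; rewrite H_homog ?invr_ge0// normrM normfV normr_id.
by rewrite mulrC ler_pdivrMr.
Qed.

Fact norm_phc : (fun t : 'rV[R]_n => `|t|) \in @phc R n.
Proof.
apply/phcP; split=> [a t a0|t]; last exact: norm_continuous.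
by rewrite normrZ ger0_norm.
Qed.

Definition normH : Hn R n := MkH norm_phc.

End PositivelyHomogeneous.

(** * Lattice operations transported from functions *)

Section Calculus.
Context (R : realType) (X : lmodType R).
Context (Phi : forall n : nat, ('I_n.+1 -> X) -> Hn R n.+1 -> X).
Context (Phi_linear : forall (n : nat) (x : 'I_n.+1 -> X), linear (Phi n x)).
Context (Phi_proj : forall (n : nat) (x : 'I_n.+1 -> X) (i : 'I_n.+1),
  Phi n x (Hproj i) = x i).
Context (Phi_comp : forall (m n : nat) (x : 'I_n.+1 -> X)
    (f : 'I_m.+1 -> Hn R n.+1) (g : Hn R m.+1),
  Phi m (fun i : 'I_m.+1 => Phi n x (f i)) g = Phi n x (Hcomp g f)).

HB.instance Definition _ n (x : 'I_n.+1 -> X) :=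
  GRing.isLinear.Build R (Hn R n.+1) X _ (Phi n x) (Phi_linear n x).

Definition pair_tuple {T : Type} (x y : T) (i : 'I_2) : T :=
  if i == ord0 then x else y.

Definition join x y : X :=
  Phi 1 (pair_tuple x y) (Hmax (Hproj ord0) (Hproj ord_max)).

Definition meet x y : X :=
  Phi 1 (pair_tuple x y) (Hmin (Hproj ord0) (Hproj ord_max)).

(** The composition law at two variables, from which [Phi_max] and [Phi_min]
    follow by taking for [h] the two lattice operations of the plane. *)
Lemma Phi_pair n (x : 'I_n.+1 -> X) f g h :
  Phi 1 (pair_tuple (Phi n x f) (Phi n x g)) h =
  Phi n x (Hcomp h (pair_tuple f g)).
Proof.
rewrite -Phi_comp; congr (Phi 1 _ h); apply/funext => i.
by rewrite /pair_tuple; case: ifP.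
Qed.

Lemma Phi_max n (x : 'I_n.+1 -> X) f g :
  Phi n x (Hmax f g) = join (Phi n x f) (Phi n x g).
Proof.
rewrite /join Phi_pair; congr (Phi n x _); apply: Hn_ext => t /=.
by rewrite !mxE.
Qed.

Lemma Phi_min n (x : 'I_n.+1 -> X) f g :
  Phi n x (Hmin f g) = meet (Phi n x f) (Phi n x g).
Proof.
rewrite /meet Phi_pair; congr (Phi n x _); apply: Hn_ext => t /=.
by rewrite !mxE.
Qed.

(** The source of every identity below: an equation in three unknowns may be
    proved with the unknowns replaced by [Phi n v f], [Phi n v g] and
    [Phi n v h] for one and the same tuple [v], that is, pointwise. *)
Lemma common_calculus (P : X -> X -> X -> Prop) :
  (forall n (v : 'I_n.+1 -> X) f g h,
     P (Phi n v f) (Phi n v g) (Phi n v h)) ->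
  forall x y z, P x y z.
Proof.
move=> Pv x y z; pose v (i : 'I_3) := nth 0 [:: x; y; z] i.
have := Pv 2 v (Hproj (inord 0)) (Hproj (inord 1)) (Hproj (inord 2)).
by rewrite !Phi_proj /v !inordK.
Qed.

Lemma joinxx x : join x x = x.
Proof.
apply: (common_calculus (fun x _ _ => join x x = x)) => // n v f _ _.
by rewrite -Phi_max; congr Phi; apply: Hn_ext => t /=; rewrite maxxx.
Qed.

Lemma joinC x y : join x y = join y x.
Proof.
apply: (common_calculus (fun x y _ => join x y = join y x)) => // n v f g _.
by rewrite -!Phi_max; congr Phi; apply: Hn_ext => t /=; rewrite maxC.
Qed.

Lemma joinA x y z : join x (join y z) = join (join x y) z.
Proof.
move: x y z; apply: common_calculus => n v f g h.
by rewrite -!Phi_max; congr Phi; apply: Hn_ext => t /=; rewrite maxA.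
Qed.

Lemma joinDr x y z : join (x + z) (y + z) = join x y + z.
Proof.
move: x y z; apply: common_calculus => n v f g h.
rewrite -!linearD -!Phi_max -linearD; congr Phi; apply: Hn_ext => t.
by rewrite [RHS]addr_maxl.
Qed.

Lemma joinZ (a : R) x y : 0 <= a -> join (a *: x) (a *: y) = a *: join x y.
Proof.
move=> a0; apply: (common_calculus
  (fun x y _ => join (a *: x) (a *: y) = a *: join x y)) => // n v f g _.
rewrite -!(linearZ_LR (Phi n v)) -!Phi_max -(linearZ_LR (Phi n v)).
congr Phi; apply: Hn_ext => t.
by rewrite [RHS]maxr_pMr.
Qed.

Lemma join_meetr x y z : join x (meet y z) = meet (join x y) (join x z).
Proof.
move: x y z; apply: common_calculus => n v f g h.
rewrite -Phi_min -!Phi_max -Phi_min.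
by congr Phi; apply: Hn_ext => t /=; rewrite max_minr.
Qed.

Lemma meetKl x y : join (meet x y) x = x.
Proof.
apply: (common_calculus (fun x y _ => join (meet x y) x = x)) => // n v f g _.
rewrite -Phi_min -Phi_max; congr Phi; apply: Hn_ext => t /=.
by rewrite maxC minKx.
Qed.

Lemma meetKr x y : join (meet x y) y = y.
Proof.
apply: (common_calculus (fun x y _ => join (meet x y) y = y)) => // n v f g _.
by rewrite -Phi_min -Phi_max; congr Phi; apply: Hn_ext => t /=; rewrite minxK.
Qed.

(** * The order *)

Definition le_join x y : Prop := join x y = y.

Lemma le_join_anti x y : le_join x y -> le_join y x -> x = y.
Proof. by move=> xy yx; rewrite -yx joinC. Qed.

Lemma le_join_trans x y z : le_join x y -> le_join y z -> le_join x z.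
Proof. by rewrite /le_join => xy <-; rewrite joinA xy. Qed.

Lemma le_join_add x y z : le_join x y -> le_join (x + z) (y + z).
Proof. by rewrite /le_join joinDr => ->. Qed.

Lemma le_join_scale (a : R) x y :
  0 <= a -> le_join x y -> le_join (a *: x) (a *: y).
Proof. by move=> a0; rewrite /le_join joinZ// => ->. Qed.

Lemma le_join_joinP x y z :
  le_join (join x y) z <-> le_join x z /\ le_join y z.
Proof.
rewrite /le_join; split=> [<-|[xz yz]]; last by rewrite -joinA yz.
by rewrite !joinA joinxx (joinC y x) -(joinA x y y) joinxx.
Qed.

(** Although the order is defined from the join alone, [meet x y] is the
    greatest lower bound: distributivity yields [z \/ (x /\ y) = x /\ y] from
    [z \/ x = x] and [z \/ y = y]. *)
Lemma le_join_meetP x y z :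
  le_join z (meet x y) <-> le_join z x /\ le_join z y.
Proof.
split=> [zxy|[zx zy]]; last by rewrite /le_join join_meetr zx zy.
by split; apply: le_join_trans zxy _; [exact: meetKl|exact: meetKr].
Qed.

Definition calculus_lattice : vectorLattice X :=
  VectorLattice joinxx le_join_anti le_join_trans le_join_add le_join_scale
    le_join_joinP le_join_meetP.

Lemma calculus_latticeP : function_calculus calculus_lattice Phi.
Proof.
by split=> // n x; split; [exact: Phi_linear|exact: Phi_max|exact: Phi_min].
Qed.

Lemma Phi_mono n (x : 'I_n.+1 -> X) f g :
  Hle f g -> le_join (Phi n x f) (Phi n x g).
Proof.
move=> fg; rewrite /le_join -Phi_max; congr Phi; apply: Hn_ext => t.
exact/max_r/fg.
Qed.

(** * The Archimedean property and closed kernels *)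

(** The functions [max 0 (t_1 - t_2 / (k + 1))] lie in the kernel at [(x, y)]
    and are within [1 / (k + 1)] of [max 0 t_1] on the sphere, so that
    [x = max 0 x = 0]. *)
Lemma archimedean_of_closed_ker :
  (forall n (x : 'I_n.+1 -> X), closed [set f : Hn R n.+1 | Phi n x f = 0]) ->
  archimedean calculus_lattice.
Proof.
move=> ker_closed x y x0 _ nxy.
pose v := pair_tuple x y; pose p := @Hproj R 2 ord0.
pose q := @Hproj R 2 ord_max.
have pE : Phi 1 v p = x by exact: Phi_proj.
have qE : Phi 1 v q = y by exact: Phi_proj.
suff : Phi 1 v (Hmax 0 p) = 0.
  by rewrite Phi_max linear0 pE => xp0; rewrite -x0.
apply: (ker_closed 1%N v (Hmax 0 p)) => B.
move/nbhs_ballP => [e /= e0 eB].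
have [k ke] : exists k : nat, k.+1%:R^-1 < e.
  by have [k _ /(_ _ (leqnn k))] := near_infty_natSinv_lt (PosNum e0); exists k.
exists (Hmax 0 (p - k.+1%:R^-1 *: q)); split.
  rewrite /= Phi_max linear0 linearB linearZ_LR /= pE qE.
  have k0 : 0 <= k.+1%:R^-1 :> R by rewrite invr_ge0.
  have := le_join_scale _ _ _ k0 (nxy k.+1 isT).
  rewrite -(scaler_nat _ x) scalerA mulVf ?pnatr_eq0// scale1r.
  move=> /(le_join_add _ _ (- (k.+1%:R^-1 *: y))); rewrite subrr.
  by rewrite /le_join joinC.
apply: eB; rewrite -ball_normE/=; apply: le_lt_trans ke.
apply: Hnorm_le => [|t St]; first by rewrite invr_ge0.
have tq : `|t ord0 ord_max| <= 1.
  have /sphere_max <- := St.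
  exact: (le_bigmax _ (fun j => `|t ord0 j|)).
rewrite -[leLHS]/(`|Num.max 0 (t ord0 ord0) -
  Num.max 0 (t ord0 ord0 - k.+1%:R^-1 * t ord0 ord_max)|).
apply: le_trans (dist_maxr _ _ _ _) _.
rewrite opprB addrC subrK normrM ger0_norm ?invr_ge0//.
by rewrite ler_piMr// invr_ge0.
Qed.

(** The Archimedean property is applied to [Phi n x |f|] and to the image of
    the norm: the latter dominates every multiple of the former, because [f] is
    within [1 / k] of some [g] with [Phi n x |g| = |Phi n x g| = 0]. *)
Lemma closed_ker_of_archimedean : archimedean calculus_lattice ->
  forall n (x : 'I_n.+1 -> X), closed [set f : Hn R n.+1 | Phi n x f = 0].
Proof.
move=> arch n x f fcl /=.
pose absH (g : Hn R n.+1) := Hmax g (- g).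
have absHE g t : absH g t = `|g t|.
  by rewrite -[LHS]/(Num.max (g t) (- g t)) maxrN.
have abs0 : Phi n x (absH f) = 0.
  apply: (arch _ (Phi n x normH)).
  - rewrite -(linear0 (Phi n x)); apply: Phi_mono => t.
    by rewrite absHE; exact: normr_ge0.
  - rewrite -(linear0 (Phi n x)); apply: Phi_mono => t.
    exact: normr_ge0.
  - move=> k k0.
    have kR : 0 < k%:R^-1 :> R by rewrite invr_gt0 ltr0n.
    have [g [/= g0 fg]] := fcl _ (nbhsx_ballx f _ kR).
    (* Adding a multiple of [|g|], which [Phi n x] kills, reduces the claim to
       the pointwise inequality [k |f t| <= k |g t| + |t|]. *)
    have -> : Phi n x normH = Phi n x (absH g *+ k + normH).
      rewrite linearD linearMn /= Phi_max linearN /= g0 oppr0.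
      by rewrite joinxx mul0rn add0r.
    rewrite -linearMn; apply: Phi_mono => t.
    rewrite -[leRHS]/((absH g *+ k) t + `|t|) !Hmulrn_fun !absHE.
    rewrite -lerBlDl -mulrnBl -mulr_natr -ler_pdivlMr ?ltr0n//.
    apply: le_trans (lerB_dist _ _) _; rewrite mulrC.
    apply: le_trans (le_Hnorm_norm (f - g) t) _.
    by rewrite ler_wpM2r//; move: fg; rewrite -ball_normE/= => /ltW.
apply: le_join_anti.
  rewrite -[in X in le_join _ X]abs0; apply: Phi_mono => t.
  by rewrite absHE ler_norm.
rewrite -[in X in le_join X]oppr0 -abs0 -linearN; apply: Phi_mono => t.
by rewrite -[leLHS]/(- absH f t) absHE lerNl -normrN ler_norm.
Qed.

End Calculus.

Theorem theorem1p4 (R : realType) (X : lmodType R)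
    (Phi : forall n : nat, ('I_n.+1 -> X) -> Hn R n.+1 -> X)
    (Phi_linear : forall (n : nat) (x : 'I_n.+1 -> X), linear (Phi n x))
    (Phi_proj : forall (n : nat) (x : 'I_n.+1 -> X) (i : 'I_n.+1),
       Phi n x (Hproj i) = x i)
    (Phi_comp : forall (m n : nat) (x : 'I_n.+1 -> X)
         (f : 'I_m.+1 -> Hn R n.+1) (g : Hn R m.+1),
       Phi m (fun i : 'I_m.+1 => Phi n x (f i)) g = Phi n x (Hcomp g f)) :
  exists L : vectorLattice X,
    function_calculus L Phi /\
    (archimedean L <->
     forall (n : nat) (x : 'I_n.+1 -> X),
       closed [set f : Hn R n.+1 | Phi n x f = 0]).
Proof.
exists (calculus_lattice _ _ _ Phi_linear Phi_proj Phi_comp); split.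
  exact: calculus_latticeP.
by split; [exact: closed_ker_of_archimedean|exact: archimedean_of_closed_ker].
Qed.
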